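(* Let $a>0$, $t\ge 0$ and $b>0$ be real numbers. Then $$\operatorname{erf}(\sqrt{at})=\frac{2}{\sqrt{\pi}\,\Gamma(b)}\int_{0}^{\pi/2}\gamma\!\left(\tfrac{1}{2}+b,\,at\sec^2\theta\right)\sin^{2b-1}(\theta)\,d\theta.$$ In particular, $$\operatorname{erf}(\sqrt{at})=1-\frac{2}{\pi}\int_{0}^{\pi/2}e^{-at\sec^2\theta}\,d\theta.$$
   Context: The lower incomplete gamma function is $\gamma(s,x)=\int_0^x u^{s-1}e^{-u}\,du$ for real $s>0$ and $x\ge 0$; $\Gamma$ is the Euler gamma function; $\operatorname{erf}(x)=\frac{2}{\sqrt{\pi}}\int_0^x e^{-u^2}\,du$ is the error function. *)

(* Defs.v *)
From HB Require Import structures.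
From mathcomp Require Import all_boot all_order all_algebra.
From mathcomp Require Import all_classical all_reals all_analysis.

Set Implicit Arguments.
Unset Strict Implicit.
Unset Printing Implicit Defensive.

Import Order.TTheory GRing.Theory Num.Theory.
Import numFieldNormedType.Exports.

Local Open Scope classical_set_scope.
Local Open Scope ring_scope.

(* All integrals are Lebesgue integrals: for non-integral exponents the
   integrands may be unbounded near 0. *)

(* Meaningful for s > 0 only. *)
Definition Gamma (R : realType) (s : R) : R :=
  \int[@lebesgue_measure R]_(u in `[0, +oo[) (u `^ (s - 1) * expR (- u)).

(* Meaningful for s > 0 and x >= 0 only. *)
Definition lower_gamma (R : realType) (s x : R) : R :=
  \int[@lebesgue_measure R]_(u in `[0, x]) (u `^ (s - 1) * expR (- u)).

(* The difference is the oriented integral from 0 to x, for x of any sign: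
   at least one of the two intervals is empty or {0}. *)
Definition erf (R : realType) (x : R) : R :=
  2 / Num.sqrt pi *
  (\int[@lebesgue_measure R]_(u in `[0, x]) expR (- u ^+ 2) -
   \int[@lebesgue_measure R]_(u in `[x, 0]) expR (- u ^+ 2)).

(* Takes the value 0 at the zeros of cos. *)
Definition sec (R : realType) (theta : R) : R := (cos theta)^-1.

(* Main.v *)
Require Import Defs.
From HB Require Import structures.
From mathcomp Require Import all_boot all_order all_algebra.
From mathcomp Require Import all_classical all_reals all_analysis.
From mathcomp Require Import measurable_realfun ring lra.

Set Implicit Arguments.
Unset Strict Implicit.
Unset Printing Implicit Defensive.

Import Order.TTheory GRing.Theory Num.Theory.
Import numFieldNormedType.Exports.

Local Open Scope classical_set_scope.
Local Open Scope ring_scope.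

(** Put x = a t. In the outer integral the substitution u = v sec^2 theta brings
    the domain of the lower incomplete gamma function to the fixed interval
    ]0, x[, so that Tonelli's theorem exchanges the integrals over theta and v.
    Since sec^2 = 1 + tan^2, the integrand in theta for fixed v is
    (1/2) v^(-1/2) exp(-v) times the integrand of Gamma(b) after the
    substitution u = v tan^2 theta ([gamma_integrand_swap]). What remains is
    Gamma(b)/2 times the integral of v^(-1/2) exp(-v) over ]0, x[, which
    v = y^2 turns into sqrt(pi) erf(sqrt x) ([lower_gamma_half]).

    The second formula is the case b = 1/2, where the incomplete gamma function
    is elementary, and Gamma(1/2) = sqrt(pi) comes from the Gaussian integral.

    All the integrands are nonnegative but may be singular at the ends of their
    domains, and the tangent sends a bounded interval to an unbounded one. Every
    substitution above is therefore an instance of one change of variables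
    between open intervals, [ge0_integral_substitution_oo], proved by exhausting
    the domain by compact intervals. *)

Lemma is_derive_continuous (R : realType) (F : R -> R) (x d : R) :
  is_derive x 1 F d -> {for x, continuous F}.
Proof.
by case=> dF _; apply/differentiable_continuous; rewrite -derivable1_diffP.
Qed.

(** * Change of variables on open intervals *)

Section compact_exhaustion.
Variables (R : realType) (a b : R).
Hypothesis ab : a < b.

Let h (n : nat) : R := (b - a) / n.+3%:R.

(** The denominators start at 3 so that even the first compact interval
    `[shrunk_left 0, shrunk_right 0] is nondegenerate. *)
Definition shrunk_left n := a + h n.
Definition shrunk_right n := b - h n.

Let h_gt0 n : 0 < h n. Proof. by rewrite divr_gt0// subr_gt0. Qed.

Lemma shrunk_left_lt_right n : shrunk_left n < shrunk_right n.
Proof.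
have : h n * 2 < b - a.
  by rewrite /h mulrAC ltr_pdivrMr// ltr_pM2l ?subr_gt0// ltr_nat.
by rewrite /shrunk_left /shrunk_right => ?; lra.
Qed.

Lemma shrunk_left_in n : shrunk_left n \in `]a, b[.
Proof.
have := h_gt0 n; have := shrunk_left_lt_right n.
by rewrite /shrunk_left /shrunk_right in_itv/= => ? ?; apply/andP; split; lra.
Qed.

Lemma shrunk_right_in n : shrunk_right n \in `]a, b[.
Proof.
have := h_gt0 n; have := shrunk_left_lt_right n.
by rewrite /shrunk_left /shrunk_right in_itv/= => ? ?; apply/andP; split; lra.
Qed.

Let h_noninc m n : (m <= n)%N -> h n <= h m.
Proof.
by move=> mn; rewrite ler_pM2l ?subr_gt0// lef_pV2 ?posrE// ler_nat.
Qed.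

Lemma shrunk_left_noninc m n : (m <= n)%N -> shrunk_left n <= shrunk_left m.
Proof. by move=> /h_noninc; rewrite lerD2l. Qed.

Lemma shrunk_right_nondec m n : (m <= n)%N -> shrunk_right m <= shrunk_right n.
Proof. by move=> /h_noninc; rewrite lerD2l lerN2. Qed.

Lemma itvoo_bigcup_shrunk :
  `]a, b[%classic = \bigcup_n `[shrunk_left n, shrunk_right n]%classic.
Proof.
apply/seteqP; split => x /=; rewrite ?in_itv/=; last first.
  move=> [n _]/=; have := shrunk_left_in n; have := shrunk_right_in n.
  rewrite !in_itv/=.
  by move=> /andP[? ?] /andP[? ?] /andP[? ?]; apply/andP; split; lra.
move=> /andP[ax xb].
pose m := Num.min (x - a) (b - x).
have m0 : 0 < m by rewrite lt_min !subr_gt0 ax.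
exists (Num.bound ((b - a) / m)) => //=.
have : h (Num.bound ((b - a) / m)) <= m.
  rewrite /h ler_pdivrMr// mulrC -ler_pdivrMr//.
  apply: (le_trans (ltW (archi_boundP _))).
    by rewrite divr_ge0// ?ltW//; lra.
  by rewrite ler_nat -addn3 leq_addr.
rewrite /m in_itv/= /shrunk_left /shrunk_right le_min => /andP[? ?].
by apply/andP; split; lra.
Qed.

End compact_exhaustion.

(** The compact-interval change of variables asks for continuity of [G] and a
    finite limit of the derivative at both ends; here neither [G] nor [f] is
    constrained at the ends of the interval, which may be singular points or
    be sent to infinity. The equality holds on each compact subinterval of
    ]a, b[, and monotone convergence transports it to the union because both
    integrands are nonnegative. Surjectivity of [F] onto [J] is given by the
    right inverse [g]. *)
Lemma ge0_integral_substitution_oo (R : realType) (F f g G : R -> R) (a b : R)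
    (J : interval R) (mu := @lebesgue_measure R) :
  {in `]a, b[, forall x : R, is_derive x 1 F (f x)} ->
  {in `]a, b[, forall x, 0 < f x} ->
  {in `]a, b[, continuous f} ->
  {in `]a, b[, forall x, F x \in J} ->
  {in J, forall y, g y \in `]a, b[} ->
  {in J, cancel g F} ->
  {in J, continuous G} ->
  {in J, forall y, 0 <= G y} ->
  (\int[mu]_(y in [set` J]) (G y)%:E =
   \int[mu]_(x in `]a, b[) (G (F x) * f x)%:E)%E.
Proof.
move=> dF f0 cf FJ gI gK cG G0.
have cF : {in `]a, b[, continuous F}.
  by move=> x /dF; exact: is_derive_continuous.
have dFE : {in `]a, b[, F^`()%classic =1 f}.
  by move=> x xab; rewrite derive1E; have [_ ->] := dF _ xab.
have incrF : {in `]a, b[ &, {homo F : x y / x < y}}.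
  apply: (@gtr0_derive1_lt_oo R F a b) => //.
  + by move=> z /dF[].
  + by move=> z zab; rewrite dFE// f0.
  + by move=> z; rewrite inE => /cF.
have ndF : {in `]a, b[ &, {homo F : x y / x <= y}}.
  move=> x y xI yI; rewrite le_eqVlt => /predU1P[->//|xy].
  by rewrite ltW// incrF.
have cdF : {in `]a, b[, continuous F^`()%classic}.
  move=> x xab; have := cf _ xab; rewrite /prop_for /continuous_at dFE//.
  apply: cvg_trans; apply: near_eq_cvg.
  by near=> y; rewrite dFE//; near: y; exact: near_in_itvoo.
(* An empty ]a, b[ forces J to be empty, since g maps J into it. *)
have [ba|ab] := leP b a.
  rewrite [X in (\int[_]_(x in X) _)%E](_ : _ = set0); last first.
    apply/seteqP; split => // y /= /gI; rewrite in_itv/= => /andP[ay yb]; lra.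
  by rewrite set_itv_ge ?bnd_simp -?leNgt// !integral_set0.
pose U n := `[shrunk_left a b n, shrunk_right a b n]%classic.
pose V n := `[F (shrunk_left a b n), F (shrunk_right a b n)]%classic.
have UI n x : U n x -> x \in `]a, b[.
  move=> Ux; have : (\bigcup_n U n) x by [exists n].
  by rewrite -itvoo_bigcup_shrunk.
have VJ : [set` J] = \bigcup_n V n.
  apply/seteqP; split => y /=.
    move=> yJ; have := gI _ yJ => gyI.
    have : (\bigcup_n U n) (g y) by rewrite -itvoo_bigcup_shrunk.
    move=> [n _ Un]; exists n => //; rewrite /V/= in_itv/=.
    rewrite -[in X in X && _](gK y)//.
    rewrite -[in X in _ && X](gK y)//.
    have := Un; rewrite /U/= in_itv/= => /andP[? ?].
    apply/andP; split; apply: ndF => //.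
    + exact: shrunk_left_in.
    + exact: shrunk_right_in.
  move=> [n _ yV]; apply: (interval_is_interval (i := J) _ _ yV).
  - exact: FJ (shrunk_left_in ab n).
  - exact: FJ (shrunk_right_in ab n).
have step n : (\int[mu]_(y in V n) (G y)%:E =
               \int[mu]_(x in U n) (G (F x) * f x)%:E)%E.
  rewrite integration_by_substitution_increasing.
  - apply: eq_integral => x; rewrite inE => /UI xI.
    by rewrite /= -[RHS]/((G (F x) * f x)%:E) fctE /= dFE.
  - exact/ltW/shrunk_left_lt_right.
  - move=> x y xU yU; apply: incrF; exact: (UI n).
  - move=> x xU; apply: cdF; apply: (UI n); exact: subset_itv_oo_cc.
  - have := cdF _ (shrunk_left_in ab n) => /cvg_at_right_filter; exact: cvgP.
  - have := cdF _ (shrunk_right_in ab n) => /cvg_at_left_filter; exact: cvgP.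
  - split.
    + move=> x xU; have [] // := dF x.
      apply: (UI n); exact: subset_itv_oo_cc.
    + by apply: cvg_at_right_filter; apply: cF; exact: shrunk_left_in.
    + by apply: cvg_at_left_filter; apply: cF; exact: shrunk_right_in.
  - apply: continuous_in_subspaceT => y; rewrite inE => yV; apply: cG.
    by have : (\bigcup_n V n) y by [exists n]; rewrite -VJ.
have mU n : measurable (U n) by exact: measurable_itv.
have mV n : measurable (V n) by exact: measurable_itv.
have limV : (\int[mu]_(y in V n) (G y)%:E @[n --> \oo] -->
             \int[mu]_(y in [set` J]) (G y)%:E)%E.
  rewrite VJ; apply: ge0_nondecreasing_set_cvg_integral => //.
  - move=> m n mn; apply/subsetPset => y.
    rewrite /V/= !in_itv/= => /andP[y1 y2].
    apply/andP; split.
      apply: le_trans y1; apply: ndF.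
      + exact: shrunk_left_in.
      + exact: shrunk_left_in.
      + exact: shrunk_left_noninc.
    apply: (le_trans y2); apply: ndF.
    + exact: shrunk_right_in.
    + exact: shrunk_right_in.
    + exact: shrunk_right_nondec.
  - move=> n; apply/measurable_EFinP.
    apply: subspace_continuous_measurable_fun => //.
    apply: continuous_in_subspaceT => y; rewrite inE => yV; apply: cG.
    by have : (\bigcup_n V n) y by [exists n]; rewrite -VJ.
  - move=> n y Vy; rewrite lee_fin; apply: G0.
    by have : (\bigcup_n V n) y by [exists n]; rewrite -VJ.
have limU : (\int[mu]_(x in U n) (G (F x) * f x)%:E @[n --> \oo] -->
             \int[mu]_(x in `]a, b[) (G (F x) * f x)%:E)%E.
  rewrite itvoo_bigcup_shrunk//.
  apply: ge0_nondecreasing_set_cvg_integral => //.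
  - move=> m n mn; apply/subsetPset => y.
    rewrite /U/= !in_itv/= => /andP[y1 y2].
    apply/andP; split.
      by apply: le_trans y1; rewrite shrunk_left_noninc.
    by apply: (le_trans y2); rewrite shrunk_right_nondec.
  - move=> n; apply/measurable_EFinP.
    apply: subspace_continuous_measurable_fun => //.
    apply: continuous_in_subspaceT => x; rewrite inE => /UI xI.
    apply: cvgM; last exact: cf.
    by apply: continuous_comp; [exact: cF|apply: cG; exact: FJ].
  - move=> n x /UI xI; rewrite lee_fin mulr_ge0//.
      by apply: G0; exact: FJ.
    by rewrite ltW// f0.
apply: (cvg_unique _ limV) => //; apply: cvg_trans limU; apply: near_eq_cvg.
by apply: nearW => n; rewrite step.
Unshelve. all: by end_near. Qed.

(** * Tonelli on a rectangle *)

Section tonelli_setX.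
Context d1 d2 (T1 : measurableType d1) (T2 : measurableType d2) (R : realType).
Variables (m1 : {sigma_finite_measure set T1 -> \bar R})
  (m2 : {sigma_finite_measure set T2 -> \bar R}).
Variables (A : set T1) (B : set T2) (f : T1 * T2 -> \bar R).
Hypotheses (mA : measurable A) (mB : measurable B)
  (mf : measurable_fun (A `*` B) f)
  (f0 : forall x y, A x -> B y -> (0 <= f (x, y))%E).

Let h := f \_ (A `*` B).

Let hE x y : h (x, y) = if (x \in A) && (y \in B) then f (x, y) else 0%E.
Proof. by rewrite /h patchE in_setX. Qed.

Let mh : measurable_fun setT h.
Proof. exact/(measurable_restrictT f (measurableX mA mB)). Qed.

Let h0 z : (0 <= h z)%E.
Proof.
case: z => x y; rewrite hE; case: ifP => // /andP[/set_mem ? /set_mem ?].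
exact: f0.
Qed.

Lemma measurable_fun_integral_setX :
  measurable_fun A (fun x => \int[m2]_(y in B) f (x, y))%E.
Proof.
have := @measurable_fun_fubini_tonelli_F _ _ _ _ _ m2 h mh h0.
move=> /(@measurable_funTS _ _ _ _ A); apply: eq_measurable_fun => x xA.
rewrite /fubini_F [RHS]integral_mkcond; apply: eq_integral => y _.
by rewrite patchE hE xA.
Qed.

Lemma ge0_tonelli_setX :
  (\int[m1]_(x in A) \int[m2]_(y in B) f (x, y) =
   \int[m2]_(y in B) \int[m1]_(x in A) f (x, y))%E.
Proof.
transitivity (\int[m1]_x \int[m2]_y h (x, y))%E.
  rewrite integral_mkcond; apply: eq_integral => x _; rewrite patchE.
  case: ifPn => xA.
    rewrite integral_mkcond; apply: eq_integral => y _.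
    by rewrite patchE hE xA.
  by rewrite integral0_eq// => y _; rewrite hE (negbTE xA).
rewrite (fubini_tonelli h mh h0).
rewrite [RHS]integral_mkcond; apply: eq_integral => y _.
rewrite patchE; case: ifPn => yB.
  rewrite [RHS]integral_mkcond; apply: eq_integral => x _.
  by rewrite patchE hE yB andbT.
by rewrite integral0_eq// => x _; rewrite hE (negbTE yB) andbF.
Qed.

End tonelli_setX.

(** * The gamma and error functions as extended-real integrals *)

Section gamma.
Variable R : realType.
Let mu := @lebesgue_measure R.
Implicit Types (b s u v x y t : R).

Definition gamma_integrand s u := u `^ (s - 1) * expR (- u).

Lemma gamma_integrand_ge0 s u : 0 <= gamma_integrand s u.
Proof. by rewrite mulr_ge0 ?powR_ge0 ?expR_ge0. Qed.

Lemma measurable_gamma_integrand s (D : set R) :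
  measurable_fun D (gamma_integrand s).
Proof.
apply: measurable_funTS; apply: measurable_funM => //.
by apply: measurableT_comp.
Qed.

Let measurable_EFin_gamma_integrand s (D : set R) :
  measurable_fun D (fun u => (gamma_integrand s u)%:E).
Proof. by apply/measurable_EFinP; exact: measurable_gamma_integrand. Qed.

Let measurable_EFin_gauss_fun (D : set R) :
  measurable_fun D (fun u => (@gauss_fun R u)%:E).
Proof.
by apply/measurable_EFinP; apply: measurable_funTS; exact: measurable_gauss_fun.
Qed.

Let measurable_EFin_powR s (D : set R) :
  measurable_fun D (fun u => (u `^ s)%:E).
Proof.
by apply/measurable_EFinP; apply: measurable_funTS; exact: measurable_powR.
Qed.

Let measurable_EFin_expR_half (D : set R) :
  measurable_fun D (fun u => (expR (- (u / 2)))%:E).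
Proof.
apply/measurable_EFinP; apply: measurable_funTS.
by do 2 apply: measurableT_comp => //; exact: measurable_funM.
Qed.

Let sqr_powR_half y : 0 < y -> (y ^+ 2) `^ (2^-1 - 1) = y^-1.
Proof.
move=> y0; rewrite -powR_mulrn ?ltW// -powRrM.
by rewrite (_ : 2 * (2^-1 - 1) = -1) ?powR_inv1 ?ltW//; field.
Qed.

Lemma continuous_powR s : {in `]0, +oo[, continuous (@powR R ^~ s)}.
Proof.
move=> u; rewrite in_itv/= andbT => u0.
exact: (is_derive_continuous (is_derive1_powR s u0)).
Qed.

Lemma continuous_gamma_integrand s :
  {in `]0, +oo[, continuous (gamma_integrand s)}.
Proof.
move=> u u0; apply: cvgM; first exact: continuous_powR.
apply: continuous_comp; first exact: cvgN.
exact: continuous_expR.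
Qed.

(** The substitution u = x^b turns the constant 1 on ]0, 1[ into b x^(b-1). *)
Lemma integral_powR01 (b : R) : 0 < b ->
  (\int[mu]_(u in `]0%R, 1%R[) (u `^ (b - 1))%:E = b^-1%:E)%E.
Proof.
move=> b0; have b10 : 0 <= b^-1 by rewrite invr_ge0 ltW.
have key : (\int[mu]_(u in `]0%R, 1%R[) (cst 1 u)%:E =
   \int[mu]_(u in `]0%R, 1%R[) (cst 1 (u `^ b) * (b * u `^ (b - 1)))%:E)%E.
  apply: (ge0_integral_substitution_oo (F := @powR R ^~ b)
    (f := fun u => b * u `^ (b - 1)) (g := @powR R ^~ b^-1) (G := cst 1)).
  - by move=> u; rewrite in_itv/= => /andP[u0 u1]; exact: is_derive1_powR.
  - by move=> u; rewrite in_itv/= => /andP[u0 u1]; rewrite mulr_gt0// powR_gt0.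
  - move=> u; rewrite in_itv/= => /andP[u0 u1]; apply: cvgMr.
    by apply: continuous_powR; rewrite in_itv/= u0.
  - move=> u; rewrite !in_itv/= => /andP[u0 u1]; rewrite powR_gt0//=.
    by have := gt0_ltr_powR b0 _ _ u1; rewrite powR1 !nnegrE; apply; exact: ltW.
  - move=> u; rewrite !in_itv/= => /andP[u0 u1]; rewrite powR_gt0//=.
    have := @gt0_ltr_powR _ b^-1 _ u 1; rewrite powR1 !nnegrE invr_gt0.
    by apply => //; exact: ltW.
  - move=> u; rewrite in_itv/= => /andP[u0 u1].
    by rewrite -powRrM mulVf ?gt_eqF// powRr1// ltW.
  - by move=> u _; exact: cvg_cst.
  - by [].
have one : (\int[mu]_(u in `]0%R, 1%R[) (cst 1 u)%:E = 1)%E.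
  rewrite -[LHS]/(\int[mu]_(u in `]0%R, 1%R[) cst 1 u)%E integral_cst//=.
  by rewrite lebesgue_measure_itv/= lte_fin ltr01 sube0 mule1.
move: key; rewrite one.
under eq_integral do rewrite mul1r EFinM.
rewrite ge0_integralZl_EFin ?ltW//; last 2 first.
- by move=> u _; rewrite lee_fin powR_ge0.
- exact: measurable_EFin_powR.
move=> /(congr1 (fun z => (b^-1)%:E * z)%E).
by rewrite mule1 muleA -EFinM mulVf ?gt_eqF// mul1e.
Qed.

Lemma integral_expR_half_1y_lty :
  (\int[mu]_(u in `[1%R, +oo[) (expR (- (u / 2)))%:E < +oo)%E.
Proof.
pose F (u : R) := - 2 * expR (- (u / 2)).
have dF (x : R) : is_derive x 1 F (expR (- (x / 2))).
  apply: is_derive_eq.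
  by rewrite !(scaler0,scale0r,addr0,add0r) /GRing.scale/=; lra.
have cF : continuous F.
  by move=> x; exact: is_derive_continuous (dF x).
rewrite (@ge0_continuous_FTC2y _ _ F _ 0).
- by rewrite -EFinB ltry.
- by move=> x _; exact: expR_ge0.
- apply: continuous_subspaceT => x.
  apply: (@continuous_comp _ _ _ (fun x : R => - (x / 2)) expR).
    by apply: cvgN; apply: cvgMl; exact: cvg_id.
  exact: continuous_expR.
- rewrite -(mulr0 (- 2)); apply: cvgMr.
  apply: (cvg_comp (fun u : R => u / 2) (fun u => expR (- u))).
    exact: gt0_cvgMly.
  exact: cvgr_expR.
- by move=> x _; have [] := dF x.
- exact/cvg_at_right_filter/cF.
- by move=> x _; rewrite derive1E; have [_ ->] := dF x.
Qed.

(** From ln y < y at y = u/(2b): b ln u <= u/2 + b ln(2b), so that the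
    exponential absorbs the power at the cost of half of its exponent. *)
Lemma powR_le_expR_half (b u : R) : 0 < b -> 1 <= u ->
  u `^ (b - 1) * expR (- u) <= (2 * b) `^ b * expR (- (u / 2)).
Proof.
move=> b0 u1; have u0 : 0 < u by exact: lt_le_trans u1.
have : u `^ (b - 1) <= u `^ b by apply: ler_powR => //; lra.
move=> /le_trans; move=> /(_ ((2 * b) `^ b * expR (u / 2))) ub.
have -> : (2 * b) `^ b * expR (- (u / 2)) =
    (2 * b) `^ b * expR (u / 2) * expR (- u).
  by rewrite -mulrA -expRD; congr (_ * expR _); lra.
rewrite ler_pM2r ?expR_gt0//; apply: ub.
have bb : 0 < 2 * b by rewrite mulr_gt0.
rewrite /powR gt_eqF// gt_eqF// -expRD ler_expR.
have := ln_sublinear (divr_gt0 u0 bb).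
rewrite ln_div ?posrE// ltrBlDr => /ltW.
rewrite -(ler_pM2l b0) mulrDr => /le_trans; apply.
rewrite addrC lerD2l le_eqVlt; apply/orP; left; apply/eqP; field.
exact: lt0r_neq0.
Qed.

(** On ]0, 1[ the integrand is dominated by u^(b-1), on [1, +oo[ by a multiple
    of exp(-u/2). *)
Lemma gamma_integral_lty (b : R) : 0 < b ->
  (\int[mu]_(u in `]0%R, +oo[) (gamma_integrand b u)%:E < +oo)%E.
Proof.
move=> b0.
have split01 : `]0%R, +oo[%classic = `]0%R, 1%R[ `|` `[1%R, +oo[ :> set R.
  by apply: itv_bndbnd_setU; rewrite ?bnd_simp.
rewrite split01 ge0_integral_setU//; last 3 first.
- exact: measurable_EFin_gamma_integrand.
- by move=> u _; rewrite lee_fin gamma_integrand_ge0.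
- apply/disj_setPS => u/= []; rewrite !in_itv/= => /andP[_ ?].
  by rewrite andbT; lra.
apply: lte_add_pinfty.
  apply: (@le_lt_trans _ _ (b^-1)%:E); last by rewrite ltry.
  rewrite -integral_powR01//; apply: ge0_le_integral => //.
  - by move=> u _; rewrite lee_fin gamma_integrand_ge0.
  - exact: measurable_EFin_gamma_integrand.
  - exact: measurable_EFin_powR.
  - move=> u/=; rewrite in_itv/= => /andP[u0 u1]; rewrite lee_fin.
    by rewrite ler_piMr ?powR_ge0// -expR0 ler_expR; lra.
apply: (@le_lt_trans _ _ (\int[mu]_(u in `[1%R, +oo[)
    (((2 * b) `^ b)%:E * (expR (- (u / 2)))%:E))%E).
  apply: ge0_le_integral => //.
  - by move=> u _; rewrite lee_fin gamma_integrand_ge0.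
  - exact: measurable_EFin_gamma_integrand.
  - apply: measurable_funeM; exact: measurable_EFin_expR_half.
  - move=> u/=; rewrite in_itv/= andbT => u1.
    by rewrite -EFinM lee_fin powR_le_expR_half.
rewrite ge0_integralZl_EFin ?powR_ge0//; last first.
  exact: measurable_EFin_expR_half.
by rewrite lte_mul_pinfty ?integral_expR_half_1y_lty// lee_fin powR_ge0.
Qed.

(** [Gamma], [lower_gamma] and [erf] are real-valued integrals, which default
    to 0 when the extended-real integral is infinite. The following equalities
    record finiteness, and drop the endpoints so that the change of variables
    on open intervals applies. *)
Lemma Gamma_EFin b : 0 < b ->
  (Gamma b)%:E = (\int[mu]_(u in `]0%R, +oo[) (gamma_integrand b u)%:E)%E.
Proof.
move=> b0; rewrite integral_itv_obnd_cbnd; last first.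
  exact: measurable_EFin_gamma_integrand.
rewrite /Gamma /Rintegral fineK// ge0_fin_numE; last first.
  by apply: integral_ge0 => u _; rewrite lee_fin gamma_integrand_ge0.
rewrite -integral_itv_obnd_cbnd; last first.
  exact: measurable_EFin_gamma_integrand.
exact: gamma_integral_lty.
Qed.

Lemma Gamma_gt0 b : 0 < b -> 0 < Gamma b.
Proof.
move=> b0; rewrite -lte_fin Gamma_EFin//.
apply: (@lt_le_trans _ _ (expR (-1) * b^-1)%:E).
  by rewrite lte_fin mulr_gt0 ?expR_gt0 ?invr_gt0.
rewrite EFinM -(integral_powR01 b0) -ge0_integralZl_EFin ?expR_ge0//;
  last 2 first.
- by move=> u _; rewrite lee_fin powR_ge0.
- exact: measurable_EFin_powR.
apply: (@le_trans _ _ (\int[mu]_(u in `]0%R, 1%R[) (gamma_integrand b u)%:E)%E).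
  apply: ge0_le_integral => //.
  - by move=> u _; rewrite -EFinM lee_fin mulr_ge0 ?expR_ge0 ?powR_ge0.
  - apply: measurable_funeM; exact: measurable_EFin_powR.
  - exact: measurable_EFin_gamma_integrand.
  - move=> u /=; rewrite in_itv/= => /andP[u0 u1]; rewrite -EFinM lee_fin mulrC.
    by rewrite ler_wpM2l ?powR_ge0// ler_expR; lra.
apply: ge0_subset_integral => //.
- exact: measurable_EFin_gamma_integrand.
- by move=> u _; rewrite lee_fin gamma_integrand_ge0.
- by move=> u/=; rewrite !in_itv/= => /andP[->].
Qed.

Lemma lower_gamma_EFin s x : 0 < s ->
  (lower_gamma s x)%:E = (\int[mu]_(u in `]0%R, x[) (gamma_integrand s u)%:E)%E.
Proof.
move=> s0; have mg := measurable_EFin_gamma_integrand s.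
rewrite -(@integral_itv_bndoo _ _ _ _ true false)//.
rewrite /lower_gamma /Rintegral fineK// ge0_fin_numE; last first.
  by apply: integral_ge0 => u _; rewrite lee_fin gamma_integrand_ge0.
rewrite (@integral_itv_bndoo _ _ _ _ true false)//.
apply: le_lt_trans (gamma_integral_lty s0).
apply: ge0_subset_integral => //.
- exact: measurable_EFin_gamma_integrand.
- by move=> u _; rewrite lee_fin gamma_integrand_ge0.
- by move=> u/=; rewrite !in_itv/= => /andP[->].
Qed.

Lemma erf_EFin y : 0 <= y ->
  (erf y)%:E = ((2 / Num.sqrt pi)%:E *
                \int[mu]_(u in `]0%R, y[) (gauss_fun u)%:E)%E.
Proof.
move=> y0; have mg := measurable_EFin_gauss_fun.
have int0 : \int[mu]_(u in `[y, 0]) expR (- u ^+ 2) = 0.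
  rewrite /Rintegral; move: y0; rewrite le_eqVlt => /predU1P[<-|y0].
    by rewrite set_itv1 integral_set1.
  by rewrite set_itv_ge ?integral_set0// bnd_simp -ltNge.
rewrite /erf int0 subr0 EFinM; congr (_ * _)%E.
rewrite -(@integral_itv_bndoo _ _ _ _ true false)//.
rewrite /Rintegral fineK// ge0_fin_numE; last first.
  by apply: integral_ge0 => u _; rewrite lee_fin expR_ge0.
apply: (@le_lt_trans _ _ (\int[mu]_u (gauss_fun u)%:E)%E); last first.
  by rewrite integralT_gauss ltry.
apply: ge0_subset_integral => //.
exact: measurable_EFin_gauss_fun.
Qed.

(** The substitution u = y^2. *)
Lemma lower_gamma_half x : 0 <= x ->
  lower_gamma 2^-1 x = Num.sqrt pi * erf (Num.sqrt x).
Proof.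
move=> x0; apply: EFin_inj; rewrite EFinM erf_EFin ?sqrtr_ge0//.
rewrite muleA -EFinM mulrCA divff ?mulr1 ?gt_eqF ?sqrtr_gt0 ?pi_gt0//.
rewrite lower_gamma_EFin ?invr_gt0//.
rewrite (ge0_integral_substitution_oo (F := fun y => y ^+ 2)
  (f := fun y => 2 * y) (g := Num.sqrt) (a := 0) (b := Num.sqrt x)).
- rewrite -ge0_integralZl_EFin//; last 2 first.
  + by move=> u _; rewrite lee_fin expR_ge0.
  + exact: measurable_EFin_gauss_fun.
  apply: eq_integral => y; rewrite inE/= in_itv/= => /andP[y0 _].
  rewrite -EFinM; congr EFin; rewrite /gamma_integrand /gauss_fun.
  by rewrite sqr_powR_half//; field; exact: lt0r_neq0.
- move=> y _; apply: is_derive_eq.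
  rewrite /GRing.scale/= mulr1; ring.
- by move=> y; rewrite in_itv/= => /andP[y0 _]; rewrite mulr_gt0.
- by move=> y _; apply: cvgMr; exact: cvg_id.
- move=> y; rewrite !in_itv/= => /andP[y0 yx]; rewrite exprn_gt0//=.
  by rewrite -(sqr_sqrtr x0) ltr_pXn2r// nnegrE ?sqrtr_ge0// ltW.
- move=> y; rewrite !in_itv/= => /andP[y0 yx]; rewrite sqrtr_gt0 y0/=.
  by rewrite ltr_sqrt// (lt_trans y0).
- by move=> y; rewrite in_itv/= => /andP[y0 _]; rewrite sqr_sqrtr// ltW.
- move=> y; rewrite in_itv/= => /andP[y0 _]; apply: continuous_gamma_integrand.
  by rewrite in_itv/= y0.
- by move=> y _; exact: gamma_integrand_ge0.
Qed.

(** * Trigonometric substitutions *)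

Lemma cos_gt0_itv t : t \in `]0, (pi / 2)[ -> 0 < cos t.
Proof.
rewrite in_itv/= => /andP[t0 tpi]; apply: cos_gt0_pihalf.
by rewrite tpi andbT (lt_trans _ t0)// oppr_lt0 divr_gt0// pi_gt0.
Qed.

Lemma sin_gt0_itv t : t \in `]0, (pi / 2)[ -> 0 < sin t.
Proof. by rewrite in_itv/=; exact: sin_gt0_pihalf. Qed.

Lemma tan_gt0_itv t : t \in `]0, (pi / 2)[ -> 0 < tan t.
Proof. by move=> tI; rewrite divr_gt0 ?sin_gt0_itv ?cos_gt0_itv. Qed.

Lemma atan_in_itv y : 0 < y -> atan y \in `]0, (pi / 2)[.
Proof.
by move=> y0; rewrite in_itv/= atan_ltpi2 andbT -atan0; exact: lt_atan.
Qed.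

Lemma continuous_sec_itv : {in `]0, (pi / 2)[, continuous (@sec R)}.
Proof.
move=> t /cos_gt0_itv c0; apply: cvgV; first exact: lt0r_neq0.
exact: continuous_cos.
Qed.

Lemma continuous_sec2_itv :
  {in `]0, (pi / 2)[, continuous (fun t => sec t ^+ 2)}.
Proof.
move=> t tI; apply: (@continuous_comp _ _ _ (@sec R) (fun z => z ^+ 2)).
  exact: continuous_sec_itv.
exact: exprn_continuous.
Qed.

Lemma is_derive_tan_itv t : t \in `]0, (pi / 2)[ ->
  is_derive t (1 : R) (@tan R) (sec t ^+ 2).
Proof.
move=> /cos_gt0_itv c0; rewrite /sec exprVn.
by apply: is_derive_tan; exact: lt0r_neq0.
Qed.

Lemma integral_tan (G : R -> R) :
  {in `]0, +oo[, continuous G} -> {in `]0, +oo[, forall y, 0 <= G y} ->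
  (\int[mu]_(u in `]0%R, +oo[) (G u)%:E =
   \int[mu]_(t in `]0%R, (pi / 2)%R[) (G (tan t) * sec t ^+ 2)%:E)%E.
Proof.
move=> cG G0; apply: (ge0_integral_substitution_oo (F := @tan R)
  (f := fun t => sec t ^+ 2) (g := @atan R)) => //.
- by move=> t tI; exact: is_derive_tan_itv.
- by move=> t /cos_gt0_itv c0; rewrite exprn_gt0// invr_gt0.
- exact: continuous_sec2_itv.
- by move=> t tI; rewrite in_itv/= tan_gt0_itv.
- by move=> y; rewrite in_itv/= andbT; exact: atan_in_itv.
- by move=> y _; exact: atanK.
Qed.

Lemma integral_tan2 v (G : R -> R) : 0 < v ->
  {in `]0, +oo[, continuous G} -> {in `]0, +oo[, forall y, 0 <= G y} ->
  (\int[mu]_(u in `]0%R, +oo[) (G u)%:E =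
   \int[mu]_(t in `]0%R, (pi / 2)%R[)
     (G (v * tan t ^+ 2) * (2 * v * tan t * sec t ^+ 2))%:E)%E.
Proof.
move=> v0 cG G0; apply: (ge0_integral_substitution_oo
  (F := fun t => v * tan t ^+ 2) (f := fun t => 2 * v * tan t * sec t ^+ 2)
  (g := fun y => atan (Num.sqrt (y / v)))) => //.
- move=> t tI; have dtan := is_derive_tan_itv tI.
  by apply: is_derive_eq; rewrite /GRing.scale/=; ring.
- move=> t tI; have c0 := cos_gt0_itv tI; have tan0 := tan_gt0_itv tI.
  have sec0 : 0 < sec t by rewrite invr_gt0.
  by rewrite /= mulr_gt0 ?exprn_gt0// mulr_gt0// mulr_gt0.
- move=> t tI; apply: cvgM; last exact: continuous_sec2_itv.
  by apply: cvgMr; apply: continuous_tan; rewrite gt_eqF// cos_gt0_itv.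
- by move=> t tI; rewrite in_itv/= andbT mulr_gt0// exprn_gt0// tan_gt0_itv.
- move=> y; rewrite in_itv/= andbT => y0; apply: atan_in_itv.
  by rewrite sqrtr_gt0 divr_gt0.
- move=> y; rewrite in_itv/= andbT => y0.
  rewrite atanK sqr_sqrtr ?divr_ge0 ?ltW//.
  by rewrite mulrCA divff ?mulr1// gt_eqF.
Qed.

(** The substitution u = tan^2 t turns the integral of Gamma(1/2) into twice
    that of exp(-tan^2 t) sec^2 t, which y = tan t turns into the Gaussian
    integral. The detour keeps the domain of both substitutions bounded. *)
Lemma Gamma_half : Gamma (2^-1 : R) = Num.sqrt pi.
Proof.
apply: EFin_inj; rewrite Gamma_EFin ?invr_gt0//.
rewrite (@integral_tan2 1)//; last 2 first.
- exact: continuous_gamma_integrand.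
- by move=> y _; exact: gamma_integrand_ge0.
transitivity (2%:E * \int[mu]_(u in `]0%R, +oo[) (gauss_fun u)%:E)%E.
  rewrite integral_tan; last 2 first.
  - by move=> y _; exact: continuous_gauss_fun.
  - by move=> y _; exact: expR_ge0.
  rewrite -ge0_integralZl_EFin//; last 2 first.
  - by move=> t _; rewrite lee_fin mulr_ge0 ?expR_ge0 ?sqr_ge0.
  - apply/measurable_EFinP; apply: open_continuous_measurable_fun => // t.
    rewrite inE => tI; apply: cvgM; last exact: continuous_sec2_itv.
    apply: continuous_comp; last exact: continuous_gauss_fun.
    by apply: continuous_tan; rewrite gt_eqF// cos_gt0_itv.
  apply: eq_integral => t; rewrite inE/= => tI; rewrite -EFinM; congr EFin.
  have t0 := tan_gt0_itv tI.
  rewrite /gamma_integrand /gauss_fun mul1r.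
  by rewrite sqr_powR_half//; field; exact: lt0r_neq0.
rewrite integral_itv_obnd_cbnd; last first.
  exact: measurable_EFin_gauss_fun.
by rewrite integral0y_gauss -EFinM mulrCA divff ?mulr1.
Qed.

(** The pointwise identity behind the interchange of integrals. With c = cos t
    and s = sin t, the left side is the integrand after u = v sec^2 t; the
    right side separates a factor depending on v alone from the integrand of
    Gamma(b) after u = v tan^2 t. The exponentials agree because
    sec^2 = 1 + tan^2, and all other factors are powers of v, c and s. *)
Lemma gamma_integrand_swap (b v c s : R) : 0 < v -> 0 < c -> 0 < s ->
  c ^+ 2 + s ^+ 2 = 1 ->
  gamma_integrand (2^-1 + b) (v * c^-1 ^+ 2) * c^-1 ^+ 2 * s `^ (2 * b - 1) =
  2^-1 * gamma_integrand 2^-1 v *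
  (gamma_integrand b (v * (s / c) ^+ 2) * (2 * v * (s / c) * c^-1 ^+ 2)).
Proof.
move=> v0 c0 s0 cs; rewrite /gamma_integrand.
have cn0 := lt0r_neq0 c0.
have -> : expR (- (v * c^-1 ^+ 2)) = expR (- v) * expR (- (v * (s / c) ^+ 2)).
  rewrite -expRD; congr expR.
  have -> : v * (s / c) ^+ 2 = v * (1 - c ^+ 2) * c^-1 ^+ 2.
    by rewrite expr_div_n exprVn (_ : s ^+ 2 = 1 - c ^+ 2) ?mulrA//; lra.
  by field.
suff pw : (v * c^-1 ^+ 2) `^ (2^-1 + b - 1) * s `^ (2 * b - 1) =
    v `^ (2^-1 - 1) * (v * (s / c) ^+ 2) `^ (b - 1) * (v * (s / c)).
  transitivity ((v * c^-1 ^+ 2) `^ (2^-1 + b - 1) * s `^ (2 * b - 1) *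
      (expR (- v) * expR (- (v * (s / c) ^+ 2)) * c^-1 ^+ 2)); first by ring.
  by rewrite pw; field.
(* In logarithmic coordinates the equality of powers is a polynomial identity
   between exponents. *)
have [lv ->] : exists l, v = expR l by exists (ln v); rewrite lnK.
have [lc ->] : exists l, c = expR l by exists (ln c); rewrite lnK.
have [ls ->] : exists l, s = expR l by exists (ln s); rewrite lnK.
rewrite -!expRN -!expRD -!expRM_natl -!expRD /powR !gt_eqF ?expR_gt0//.
rewrite !expRK -!expRD.
by congr expR; field.
Qed.

End gamma.

(** * The two integral representations *)

Section main.
Variable R : realType.
Let mu := @lebesgue_measure R.
Implicit Types (b s u v x y t : R).

(** The integrand of the double integral over (t, v) obtained by substituting
    u = v sec^2 t in the lower incomplete gamma function. *)
Let kernel b (z : R * R) : \bar R :=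
  (gamma_integrand (2^-1 + b) (z.2 * sec z.1 ^+ 2) * sec z.1 ^+ 2 *
   sin z.1 `^ (2 * b - 1))%:E.

Let kernel_ge0 b z : (0 <= kernel b z)%E.
Proof.
rewrite lee_fin mulr_ge0 ?powR_ge0//.
by rewrite mulr_ge0 ?gamma_integrand_ge0 ?sqr_ge0.
Qed.

Let measurable_kernel b x :
  measurable_fun (`]0, (pi / 2)[ `*` `]0, x[ : set (R * R)) (kernel b).
Proof.
apply/measurable_EFinP.
have msec2 : measurable_fun (`]0, (pi / 2)[ `*` `]0, x[ : set (R * R))
    (fun z => sec z.1 ^+ 2).
  apply: (@measurable_comp _ _ _ _ _ _ (`]0, (pi / 2)[%classic : set R)
    (fun t => sec t ^+ 2) _ fst) => //.
  - by move=> _ [[t v] [tI vI] <-].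
  - apply: open_continuous_measurable_fun => // t; rewrite inE => tI.
    exact: continuous_sec2_itv.
  - by apply: measurable_funTS; exact: measurable_fst.
apply: measurable_funM; first apply: measurable_funM => //.
- apply: (@measurableT_comp _ _ _ _ _ _ (@gamma_integrand R (2^-1 + b))).
    exact: measurable_gamma_integrand.
  apply: measurable_funM => //.
  by apply: measurable_funTS; exact: measurable_snd.
- apply: measurable_funTS.
  apply: (@measurableT_comp _ _ _ _ _ _
    (fun u : R => sin u `^ (2 * b - 1)) _ fst) => //.
  apply: (@measurableT_comp _ _ _ _ _ _ (fun u : R => u `^ (2 * b - 1)) _ sin).
    exact: measurable_powR.
  by apply: continuous_measurable_fun; exact: continuous_sin.
Qed.

Let lower_gamma_sec b x t : 0 < b -> t \in `]0, (pi / 2)[ ->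
  (lower_gamma (2^-1 + b) (x * sec t ^+ 2) * sin t `^ (2 * b - 1))%:E =
  (\int[mu]_(v in `]0%R, x[) kernel b (t, v))%E.
Proof.
move=> b0 tI; set k := sec t ^+ 2.
have k0 : 0 < k by rewrite exprn_gt0// invr_gt0 cos_gt0_itv.
rewrite EFinM lower_gamma_EFin ?addr_gt0 ?invr_gt0//.
rewrite (ge0_integral_substitution_oo (F := fun v => v * k) (f := cst k)
  (g := fun u => u / k) (a := 0) (b := x)).
- rewrite muleC -ge0_integralZl_EFin ?powR_ge0//; last 2 first.
  + by move=> u _; rewrite lee_fin mulr_ge0 ?gamma_integrand_ge0// ltW.
  + apply/measurable_EFinP; apply: measurable_funM => //.
    apply: measurableT_comp; first exact: measurable_gamma_integrand.
    exact: measurable_funM.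
  by apply: eq_integral => v _; rewrite -EFinM mulrC.
- by move=> v _; apply: is_derive_eq; rewrite /GRing.scale/=; ring.
- by [].
- by move=> v _; exact: cvg_cst.
- by move=> v; rewrite !in_itv/= => /andP[v0 vx]; rewrite mulr_gt0//= ltr_pM2r.
- move=> u; rewrite !in_itv/= => /andP[u0 ux].
  by rewrite divr_gt0//= ltr_pdivrMr.
- by move=> u _; rewrite divfK// gt_eqF.
- move=> u; rewrite in_itv/= => /andP[u0 _]; apply: continuous_gamma_integrand.
  by rewrite in_itv/= u0.
- by move=> u _; exact: gamma_integrand_ge0.
Qed.

Let integral_kernel b v : 0 < b -> 0 < v ->
  (\int[mu]_(t in `]0%R, (pi / 2)%R[) kernel b (t, v) =
   (2^-1 * gamma_integrand 2^-1 v)%:E * (Gamma b)%:E)%E.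
Proof.
move=> b0 v0; rewrite Gamma_EFin// (integral_tan2 v0); last 2 first.
- exact: continuous_gamma_integrand.
- by move=> u _; exact: gamma_integrand_ge0.
rewrite -ge0_integralZl_EFin//; last 3 first.
- move=> t; rewrite /= => /tan_gt0_itv t0.
  rewrite lee_fin mulr_ge0 ?gamma_integrand_ge0//.
  by rewrite mulr_ge0 ?sqr_ge0// mulr_ge0 ?ltW// mulr_gt0.
- apply/measurable_EFinP; apply: open_continuous_measurable_fun => // t.
  rewrite inE => tI.
  have ct : {for t, continuous (@tan R)}.
    by apply: continuous_tan; rewrite gt_eqF// cos_gt0_itv.
  apply: cvgM; last first.
    by apply: cvgM; [exact: cvgMr|exact: continuous_sec2_itv].
  apply: (@continuous_comp _ _ _ (fun t => v * tan t ^+ 2)).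
    apply: cvgMr.
    apply: (@continuous_comp _ _ _ (@tan R) (fun z => z ^+ 2)) => //.
    exact: exprn_continuous.
  apply: continuous_gamma_integrand.
  by rewrite in_itv/= andbT mulr_gt0// exprn_gt0// tan_gt0_itv.
- by rewrite mulr_ge0 ?gamma_integrand_ge0// invr_ge0.
apply: eq_integral => t; rewrite inE/= => tI; rewrite -EFinM; congr EFin.
by rewrite /= gamma_integrand_swap ?cos_gt0_itv ?sin_gt0_itv// cos2Dsin2.
Qed.

(** The interchange leaves the integral of v^(-1/2) exp(-v) over ]0, x[ times
    Gamma(b)/2. *)
Lemma integral_lower_gamma_sec b x : 0 < b ->
  (\int[mu]_(t in `[0%R, (pi / 2)%R])
     (lower_gamma (2^-1 + b) (x * sec t ^+ 2) * sin t `^ (2 * b - 1))%:E =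
   (2^-1 * Gamma b * lower_gamma 2^-1 x)%:E)%E.
Proof.
move=> b0.
have mI : measurable_fun (`]0, (pi / 2)[ : set R) (fun t =>
  (lower_gamma (2^-1 + b) (x * sec t ^+ 2) * sin t `^ (2 * b - 1))%:E).
  apply: (@eq_measurable_fun _ _ _ _ _
    (fun t => \int[mu]_(v in `]0%R, x[) kernel b (t, v))%E).
    by move=> t; rewrite inE => tI; rewrite lower_gamma_sec.
  by apply: measurable_fun_integral_setX => //; exact: measurable_kernel.
rewrite (integral_itv_bndoo true false mI).
transitivity (\int[mu]_(t in `]0%R, (pi / 2)%R[)
  \int[mu]_(v in `]0%R, x[) kernel b (t, v))%E.
  by apply: eq_integral => t; rewrite inE => tI; rewrite lower_gamma_sec.
rewrite (@ge0_tonelli_setX _ _ _ _ R (@lebesgue_measure R) (@lebesgue_measure R)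
  _ _ (kernel b))//; last exact: measurable_kernel.
transitivity (\int[mu]_(v in `]0%R, x[)
  ((2^-1 * Gamma b)%:E * (gamma_integrand 2^-1 v)%:E))%E.
  apply: eq_integral => v; rewrite inE/= in_itv/= => /andP[v0 _].
  by rewrite integral_kernel// -!EFinM; congr EFin; ring.
rewrite ge0_integralZl_EFin//; last 3 first.
- by move=> v _; rewrite lee_fin gamma_integrand_ge0.
- by apply/measurable_EFinP; exact: measurable_gamma_integrand.
- by rewrite mulr_ge0 ?invr_ge0// ltW// Gamma_gt0.
by rewrite -lower_gamma_EFin ?invr_gt0// -EFinM.
Qed.

Lemma erf_sqrt_eq_integral b x : 0 < b -> 0 <= x ->
  ((erf (Num.sqrt x))%:E =
    (2 / (Num.sqrt pi * Gamma b))%:E *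
    \int[mu]_(t in `[0%R, (pi / 2)%R])
      (lower_gamma (2^-1 + b) (x * sec t ^+ 2) * sin t `^ (2 * b - 1))%:E)%E.
Proof.
move=> b0 x0; rewrite integral_lower_gamma_sec// lower_gamma_half// -EFinM.
have pi0 : Num.sqrt pi != 0 :> R by rewrite gt_eqF// sqrtr_gt0 pi_gt0.
have Gb0 := lt0r_neq0 (Gamma_gt0 b0).
by congr EFin; field; rewrite Gb0.
Qed.

Lemma lower_gamma1 x : 0 <= x -> lower_gamma 1 x = 1 - expR (- x).
Proof.
rewrite le_eqVlt => /predU1P[<-|x0].
  by rewrite /lower_gamma /Rintegral set_itv1 integral_set1 oppr0 expR0 subrr.
rewrite /lower_gamma /Rintegral.
pose F u : R := - expR (- u).
have dF u : is_derive u (1 : R) F (expR (- u)).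
  by apply: is_derive_eq; rewrite /GRing.scale/=; ring.
have cF : continuous F.
  by move=> u; exact: is_derive_continuous (dF u).
under eq_integral do rewrite subrr powRr0 mul1r.
rewrite (@continuous_FTC2 _ _ F)//.
- by rewrite /F oppr0 expR0 -EFinB /= opprK addrC.
- apply: continuous_subspaceT => u.
  apply: continuous_comp; last exact: continuous_expR.
  exact: cvgN.
- split; first by move=> u _; have [] := dF u.
  + exact/cvg_at_right_filter/cF.
  + exact/cvg_at_left_filter/cF.
- by move=> u _; rewrite derive1E; have [_ ->] := dF u.
Qed.

(** The case b = 1/2: the power of the sine is 1, the lower incomplete gamma
    function of parameter 1 is 1 - exp(-x), and Gamma(1/2) is sqrt(pi). *)
Lemma erf_sqrt_eq_integral_exp x : 0 <= x ->
  ((erf (Num.sqrt x))%:E =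
    1%:E - (2 / pi)%:E *
    \int[mu]_(t in `[0%R, (pi / 2)%R]) (expR (- (x * sec t ^+ 2)))%:E)%E.
Proof.
move=> x0; have pi0 : 0 < pi / 2 :> R by rewrite divr_gt0// pi_gt0.
have mE : measurable_fun (`]0, (pi / 2)[ : set R)
    (fun t => (expR (- (x * sec t ^+ 2)))%:E).
  apply/measurable_EFinP; do 2 apply: measurableT_comp => //.
  apply: measurable_funM => //; apply: open_continuous_measurable_fun => // t.
  by rewrite inE; exact: continuous_sec2_itv.
have e1 t : expR (- (x * sec t ^+ 2)) <= 1.
  by rewrite -expR0 ler_expR lerNl oppr0 mulr_ge0 ?sqr_ge0.
have mE1 : measurable_fun (`]0, (pi / 2)[ : set R)
    (fun t => (1 - expR (- (x * sec t ^+ 2)))%:E).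
  apply/measurable_EFinP; apply: measurable_funB => //.
  exact/measurable_EFinP.
have ptwise t : lower_gamma (2^-1 + 2^-1) (x * sec t ^+ 2) *
    sin t `^ (2 * 2^-1 - 1) = 1 - expR (- (x * sec t ^+ 2)).
  have -> : 2^-1 + 2^-1 = 1 :> R by field.
  rewrite lower_gamma1; last by rewrite mulr_ge0 ?sqr_ge0.
  by rewrite divff// subrr powRr0 mulr1.
rewrite (@erf_sqrt_eq_integral 2^-1) ?invr_gt0// Gamma_half.
under eq_integral do rewrite ptwise.
rewrite (integral_itv_bndoo true false mE) (integral_itv_bndoo true false mE1).
(* A + B is the length of the interval, so both are finite and A can be
   traded for pi/2 - B. *)
set A := (\int[mu]_(t in _) _)%E; set B := (\int[mu]_(t in _) _)%E.
have AB : (A + B = (pi / 2)%:E)%E.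
  rewrite /A /B -ge0_integralD//; last first.
    by move=> t _; rewrite lee_fin subr_ge0.
  transitivity (\int[mu]_(t in `]0%R, (pi / 2)%R[) cst 1 t)%E.
    by apply: eq_integral => t _; rewrite /= -EFinD subrK.
  by rewrite integral_cst//= lebesgue_measure_itv/= lte_fin pi0 sube0 mul1e.
have A0 : (0 <= A)%E by apply: integral_ge0 => t _; rewrite lee_fin subr_ge0.
have B0 : (0 <= B)%E by apply: integral_ge0 => t _; rewrite lee_fin expR_ge0.
move: AB A0 B0; case: A => [A| |]; case: B => [B| |]// [AB] _ _.
rewrite -!EFinM -EFinB; congr EFin.
rewrite -expr2 sqr_sqrtr ?pi_ge0//.
have -> : A = pi / 2 - B by rewrite -AB addrK.
(* The remaining identity holds for any nonzero number in place of pi. *)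
by move: (@pi R) (lt0r_neq0 (pi_gt0 R)) => p p0; field.
Qed.

End main.

(* The outer integrals are extended-real valued Lebesgue integrals of
   nonnegative functions, so the equalities include their finiteness. *)
Theorem corollary2p8 (R : realType) (a t b : R)
    (ha : 0 < a) (ht : 0 <= t) (hb : 0 < b) :
  ((erf (Num.sqrt (a * t)))%:E =
    (2 / (Num.sqrt pi * Gamma b))%:E *
    \int[@lebesgue_measure R]_(theta in `[0%R, (pi / 2)%R])
      (lower_gamma (2^-1 + b) (a * t * sec theta ^+ 2) *
        sin theta `^ (2 * b - 1))%:E)%E
  /\
  ((erf (Num.sqrt (a * t)))%:E =
    1%:E -
    (2 / pi)%:E *
    \int[@lebesgue_measure R]_(theta in `[0%R, (pi / 2)%R])
      (expR (- (a * t * sec theta ^+ 2)))%:E)%E.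
Proof.
have at0 : 0 <= a * t by rewrite mulr_ge0// ltW.
by split; [exact: erf_sqrt_eq_integral|exact: erf_sqrt_eq_integral_exp].
Qed.
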